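(* Let $(\Omega,\mathcal{F},\mathbb{P})$ be a probability space and let $\mathcal{G}$ be a sub-$\sigma$-algebra of $\mathcal{F}$. For every random variable $X\in L^1(\Omega,\mathcal{F},\mathbb{P})$ there is a unique $\xi\in L^1(\Omega,\mathcal{G},\mathbb{P})$ such that $$\int_A X\,d\mathbb{P}=\int_A \xi\,d\mathbb{P}\qquad\text{for all }A\in\mathcal{G}.$$ In consequence, the conditional expectation $\mathbb{E}(X\mid\mathcal{G})$ exists.
   Context: Random variables are real-valued, and elements of $L^1$ are identified when they agree $\mathbb{P}$-almost surely. $L^1(\Omega,\mathcal{G},\mathbb{P})$ is the space of $\mathcal{G}$-measurable $\mathbb{P}$-integrable functions. The conditional expectation of $X\in L^1(\Omega,\mathcal{F},\mathbb{P})$ given $\mathcal{G}$ is the unique function $\mathbb{E}(X\mid\mathcal{G})\in L^1(\Omega,\mathcal{G},\mathbb{P})$ with $\int_\Omega X\mathbf{1}_A\,d\mathbb{P}=\int_\Omega\mathbb{E}(X\mid\mathcal{G})\mathbf{1}_A\,d\mathbb{P}$ for all $A\in\mathcal{G}$. *)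

(* Defs.v *)
From HB Require Import structures.
From mathcomp Require Import all_boot all_order all_algebra.
From mathcomp Require Import all_classical all_reals all_analysis.

Set Implicit Arguments.
Unset Strict Implicit.
Unset Printing Implicit Defensive.

Import Order.TTheory GRing.Theory Num.Theory.
Import numFieldNormedType.Exports.

Local Open Scope classical_set_scope.
Local Open Scope ring_scope.

Definition sub_sigma_algebra_of d (Omega : measurableType d)
    (G : set (set Omega)) : Prop :=
  sigma_algebra [set: Omega] G /\ G `<=` @measurable d Omega.

(* The sets measurable in g_sigma_algebraType G are those of <<s G >>, which is
   G itself whenever G is a sigma-algebra. *)
Definition measurable_wrt d (Omega : measurableType d) (R : realType)
    (G : set (set Omega)) (f : Omega -> R) : Prop :=
  measurable_fun [set: g_sigma_algebraType G] f.

(* Representatives of the elements of L^1(Omega, G, P). *)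
Definition L1 d (Omega : measurableType d) (R : realType)
    (P : probability Omega R) (G : set (set Omega)) : set (Omega -> R) :=
  [set f | measurable_wrt G f /\ P.-integrable [set: Omega] (EFin \o f)].

(* Existence and uniqueness in L^1(Omega, G, P), whose elements are classes of
   functions modulo P-almost sure equality. *)
Definition is_unique_L1 d (Omega : measurableType d) (R : realType)
    (P : probability Omega R) (G : set (set Omega))
    (Q : (Omega -> R) -> Prop) (f : Omega -> R) : Prop :=
  [/\ L1 P G f, Q f &
      forall g, L1 P G g -> Q g -> {ae P, forall w, g w = f w}].

Definition is_cond_expectation d (Omega : measurableType d) (R : realType)
    (P : probability Omega R) (G : set (set Omega)) (X : Omega -> R)
    (Y : Omega -> R) : Prop :=
  is_unique_L1 P G
    (fun Z => forall A, G A ->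
       (\int[P]_w (X w * \1_A w)%:E = \int[P]_w (Z w * \1_A w)%:E)%E) Y.

(* Main.v *)
(* Push P forward along the identity (Omega, F) -> (Omega, G), i.e. restrict it
   to G.  The charge A |-> \int_A X dP on G is dominated by this restriction,
   and its Radon-Nikodym derivative, which is G-measurable by construction, is
   the required xi.  Uniqueness is the fact that integrable functions on
   (Omega, G) with the same integral over every set of G agree almost
   everywhere. *)
Require Import Defs.
From HB Require Import structures.
From mathcomp Require Import all_boot all_order all_algebra.
From mathcomp Require Import all_classical all_reals all_analysis.
From mathcomp Require Import measurable_realfun.

Import Order.TTheory GRing.Theory Num.Theory.
Import numFieldNormedType.Exports.

Local Open Scope classical_set_scope.
Local Open Scope ring_scope.

Lemma integral_indicr (d : measure_display) (T : measurableType d)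
    (R : realType) (mu : {measure set T -> \bar R}) (f : T -> R) (A : set T) :
  (\int[mu]_(x in A) (f x)%:E = \int[mu]_x (f x * \1_A x)%:E)%E.
Proof. by rewrite integral_mkcond epatch_indic. Qed.

(** Domination only has to be tested on measurable null sets, and an integral over a null set
    vanishes. *)
Lemma dominates_induced_charge (d : measure_display) (T : measurableType d)
    (R : realType) (mu : {measure set T -> \bar R}) (f : T -> \bar R)
    (intf : mu.-integrable [set: T] f) :
  induced_charge intf `<< mu.
Proof.
apply/null_content_dominatesP => A mA muA; apply: null_set_integral => //.
by apply: (measurable_int mu); exact: integrableS intf.
Qed.

Section measurable_map.
Context {d1 d2 : measure_display} {T1 : measurableType d1}
  {T2 : measurableType d2} {R : realType} {P : probability T1 R}.
Context (phi : {mfun T1 >-> T2}).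

(** Here [xi] is the Radon-Nikodym derivative of the pushed-forward charge of [X] with respect to
    the distribution of [phi]; change of variables brings its integrals back to [P]. *)
Lemma integral_comp_mfun_density (X : T1 -> R) :
  P.-integrable [set: T1] (EFin \o X) ->
  exists xi : T2 -> R,
    [/\ measurable_fun [set: T2] xi,
        P.-integrable [set: T1] (EFin \o (xi \o phi)) &
        forall A, measurable A ->
          (\int[P]_(x in phi @^-1` A) (X x)%:E =
           \int[P]_(x in phi @^-1` A) (xi (phi x))%:E)%E].
Proof.
move=> hX.
have mphi : measurable_fun [set: T1] phi by [].
have numu : pushforward (induced_charge hX) phi `<< distribution P phi.
  by apply: dominates_pushforward => //; exact: dominates_induced_charge.
have [f [ff intf fE]] : exists f : T2 -> \bar R,
    [/\ forall y, f y \is a fin_num,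
        (distribution P phi).-integrable [set: T2] f &
        forall A, measurable A ->
          (\int[P]_(x in phi @^-1` A) (X x)%:E =
           \int[distribution P phi]_(y in A) f y)%E].
  unshelve eexists (Radon_Nikodym (pushforward (induced_charge hX) phi)
    (distribution P phi)); first exact: mphi.
  split.
  - by move=> y; apply: Radon_Nikodym_fin_num; exact: numu.
  - by apply: Radon_Nikodym_integrable; exact: numu.
  - by move=> A mA; rewrite -Radon_Nikodym_integral//.
(* The derivative is extended-real valued but finite at every point, so [fine] yields a real
   function without changing any value. *)
have fEfine : f = EFin \o (fine \o f).
  by apply/funext => y /=; rewrite fineK.
have mf : measurable_fun [set: T2] f by exact: measurable_int intf.
have intfphi : P.-integrable [set: T1] (f \o phi).
  (* Change of variables for the nonnegative function [|f|] transfers finiteness of its integral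
     from the distribution to [P]. *)
  apply/integrableP; split; first exact: measurableT_comp.
  have /integrableP[_] := intf.
  by rewrite ge0_integral_pushforward//; exact: measurableT_comp.
exists (fine \o f); split.
- by apply/measurable_EFinP; rewrite -fEfine.
- by rewrite (_ : EFin \o _ = f \o phi)// [in RHS]fEfine.
- move=> A mA; rewrite fE// integral_pushforward//.
    by apply: eq_integral => x _ /=; rewrite fineK.
  apply: integrableS intfphi => //.
  by rewrite -[X in measurable X]setTI; exact: mphi.
Qed.

(** Seen on [T2] under the distribution of [phi], the hypothesis compares integrals over all
    measurable sets, which forces almost everywhere equality there. *)
Lemma integral_comp_mfun_ae_eq (f g : T2 -> R) :
  measurable_fun [set: T2] f -> measurable_fun [set: T2] g ->
  P.-integrable [set: T1] (EFin \o (f \o phi)) ->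
  P.-integrable [set: T1] (EFin \o (g \o phi)) ->
  (forall A, measurable A ->
     (\int[P]_(x in phi @^-1` A) (f (phi x))%:E =
      \int[P]_(x in phi @^-1` A) (g (phi x))%:E)%E) ->
  {ae P, forall x, f (phi x) = g (phi x)}.
Proof.
move=> mf mg intf intg fg.
have mphi : measurable_fun [set: T1] phi by [].
have mpre A : measurable A -> measurable (phi @^-1` A).
  by move=> mA; rewrite -[X in measurable X]setTI; exact: mphi.
have : ae_eq (distribution P phi) [set: T2] (EFin \o f) (EFin \o g).
  apply: integral_ae_eq => //.
  - by apply: integrable_pushforward => //; exact/measurable_EFinP.
  - exact/measurable_EFinP.
  - move=> A _ mA; rewrite !integral_pushforward//; first exact: fg.
    + exact/measurable_EFinP.
    + by apply: integrableS intg => //; exact: mpre.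
    + exact/measurable_EFinP.
    + by apply: integrableS intf => //; exact: mpre.
(* The distribution of [N] is by definition the [P]-measure of its preimage, which is therefore
   null. *)
move=> [N [mN N0 fgN]]; exists (phi @^-1` N); split => //; first exact: mpre.
by move=> x /= fgx; apply: fgN => /= h; apply: fgx; have [] := h I.
Qed.

End measurable_map.

Theorem theorem4p3 (d : measure_display) (Omega : measurableType d)
    (R : realType) (P : probability Omega R) (G : set (set Omega))
    (hG : sub_sigma_algebra_of G) (X : {RV P >-> R})
    (hX : P.-integrable [set: Omega] (EFin \o X)) :
  (exists xi : Omega -> R,
     is_unique_L1 P G
       (fun f => forall A : set Omega, G A ->
          (\int[P]_(w in A) (X w)%:E = \int[P]_(w in A) (f w)%:E)%E) xi)
  /\ (exists Y : Omega -> R, is_cond_expectation P G X Y).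
Proof.
have [sG GF] := hG.
have sGE : <<s G >> = G by exact: sigma_algebra_id.
(* As [proj] is the identity, preimages and compositions along it reduce by computation; only the
   sigma-algebra changes. *)
pose proj : Omega -> g_sigma_algebraType G := id.
have mproj : measurable_fun [set: Omega] proj.
  by move=> _ A mA; rewrite setTI; apply: GF; rewrite -sGE.
pose phi : {mfun Omega >-> g_sigma_algebraType G} := mfun_Sub (mem_set mproj).
have exX : exists xi : Omega -> R, is_unique_L1 P G
    (fun f => forall A : set Omega, G A ->
       (\int[P]_(w in A) (X w)%:E = \int[P]_(w in A) (f w)%:E)%E) xi.
  have [xi [mxi intxi xiE]] := integral_comp_mfun_density phi X hX.
  exists xi; split => //.
    by move=> A GA; apply: xiE; rewrite /measurable /= sGE.
  move=> g [mg intg] gE.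
  apply: (integral_comp_mfun_ae_eq phi g xi) => // A mA.
  rewrite -xiE//; apply/esym/gE.
  by move: mA; rewrite /measurable /= sGE.
split; first exact: exX.
(* The same [xi] serves as conditional expectation: integrating over [A] amounts to integrating
   against its indicator. *)
have [xi [xiL1 xiE xi_uniq]] := exX.
exists xi; split; first exact: xiL1.
  by move=> A GA; rewrite -!integral_indicr; exact: xiE.
move=> g gL1 gE; apply: xi_uniq; first exact: gL1.
by move=> A GA; have := gE A GA; rewrite -!integral_indicr.
Qed.
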